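(* Let $\Phi$ be a function on CP problems $(\mathcal{R}/\mathcal{S},L)$ with $L$ a set of ground terms such that: if there are TRSs $\mathcal{R}_1,\mathcal{R}_2$ with $\mathcal{R}=\mathcal{R}_1\cup\mathcal{R}_2$, $\mathcal{R}_2$ non-collapsing, and the relative TRS $\mathcal{R}_2/(\mathcal{R}_1\cup\mathcal{S})$ is either linear and match-RT-bounded for $L$ or non-duplicating and match-raise-RT-bounded for $L$, then $\Phi(\mathcal{R}/\mathcal{S},L)=\{(\mathcal{R}_1/(\mathcal{R}_2\cup\mathcal{S}),L,f)\}$ for some such $\mathcal{R}_1,\mathcal{R}_2$, where $f(n)=n$; otherwise $\Phi(\mathcal{R}/\mathcal{S},L)=\{(\mathcal{R}/\mathcal{S},L,\mathbf{0})\}$. Then $\Phi$ is a sound CP processor.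
   Context: A relative TRS $\mathcal{A}/\mathcal{B}$ is linear (non-duplicating) if $\mathcal{A}\cup\mathcal{B}$ is; linear: no variable occurs twice in a left- or right-hand side; non-duplicating: no variable occurs more often in $r$ than in $l$; collapsing: some right-hand side is a variable. For $N\subseteq\mathbb{N}$, $\mathcal{F}_N$ has symbols $f_c$; $\mathrm{lift}_c(f)=f_c$, $\mathrm{base}(f_c)=f$, $\mathrm{height}(f_c)=c$, extended to terms, sets, TRSs. $\mathrm{FPos}(t)$: positions of function symbols; $\|t\|$: number of function symbol occurrences. $\mathrm{match}(\mathcal{A})$: rules $l'\to\mathrm{lift}_c(r)$ with $l\to r\in\mathcal{A}$, $\mathrm{base}(l')=l$, $c=1+\min\{\mathrm{height}(l'(p))\mid p\in\mathrm{FPos}(l)\}$. $\mathrm{MATCHRT}^c(\mathcal{B})$: rules $l'\to\mathrm{lift}_d(r)$ with $\mathrm{base}(l')\to r\in\mathcal{B}$, $d=\min\{c,\mathrm{height}(l'(\epsilon))\}$ if $\|\mathrm{base}(l')\|\ge\|r\|$ and $\mathrm{lift}_{\mathrm{height}(l'(\epsilon))}(\mathrm{base}(l'))=l'$, otherwise $d=\min(\{c\}\cup\{1+\mathrm{height}(l'(p))\mid p\in\mathrm{FPos}(l')\})$. $\mathrm{matchRT}(\mathcal{A}/\mathcal{B},c)=\mathrm{match}(\mathcal{A})/\mathrm{MATCHRT}^c(\mathcal{B})$. $\mathrm{Raise}(\mathcal{F})$: rules $f_c(\vec x)\to f_{c+1}(\vec x)$; $\uparrow S$: least common $\mathrm{Raise}$-reduct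 of a finite nonempty set of terms. For a TRS $\mathcal{T}$ over $\mathcal{F}_{\mathbb{N}}$, $s\rightsquigarrow_{\mathcal{T}}t$ iff there are $l\to r\in\mathcal{T}$, position $p$, context $C$, terms $s_1,\dots,s_n$ with $l=C[x_1,\dots,x_n]$ (all variable occurrences displayed), $s|_p=C[s_1,\dots,s_n]$, $\mathrm{base}(s_i)=\mathrm{base}(s_j)$ whenever $x_i=x_j$, and $t=s[r\sigma]_p$ with $\sigma(x)=\uparrow\{s_i\mid x_i=x\}$. $\rightsquigarrow_{\mathrm{matchRT}(\mathcal{A}/\mathcal{B},c)}=\rightsquigarrow^*_{\mathrm{MATCHRT}^c(\mathcal{B})}\cdot\rightsquigarrow_{\mathrm{match}(\mathcal{A})}\cdot\rightsquigarrow^*_{\mathrm{MATCHRT}^c(\mathcal{B})}$. $\mathrm{Succ}_{\to}(K)=\{t\text{ ground}\mid s\to^*t,s\in K\}$. $\mathcal{A}/\mathcal{B}$ is match-RT-bounded (match-raise-RT-bounded) for $L$ if for some $c$ all symbols in terms of $\mathrm{Succ}_{\to}(\mathrm{lift}_0(L))$ with $\to$ the relative rewrite relation of $\mathrm{matchRT}(\mathcal{A}/\mathcal{B},c)$ (resp. $\rightsquigarrow_{\mathrm{matchRT}(\mathcal{A}/\mathcal{B},c)}$) have height $\le c$. $\to_{\mathcal{A}/\mathcal{B}}=\to_{\mathcal{B}}^*\cdot\to_{\mathcal{A}}\cdot\to_{\mathcal{B}}^*$; $\mathrm{cp}(n,\to,L)=\sup\{\mathrm{dl}(t,\to)\mid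 t\in L,|t|\le n\}$. A CP processor maps a CP problem $(\mathcal{R}/\mathcal{S},L)$ to a finite set of triples $(\mathcal{R}_i/\mathcal{S}_i,L_i,f_i)$; it is sound if $\mathrm{cp}(n,\to_{\mathcal{R}/\mathcal{S}},L)=O(\sum_if_i(n)+\sum_i\mathrm{cp}(n,\to_{\mathcal{R}_i/\mathcal{S}_i},L_i))$. $\mathbf{0}$ is the zero function.
   Formalization: The TRSs R and S of a CP problem are assumed finite; for infinite TRSs the claim fails, e.g. R = R_2 = {a → f^k(e) | k ≥ 0} ∪ {f(x) → g(x)}, S empty, L = {a} is linear and match-RT-bounded, but cp is infinite. *)

(* Defs.v *)
From HB Require Import structures.
From Stdlib Require Relation_Operators.
From mathcomp Require Import all_boot all_order all_algebra.
From mathcomp Require Import all_classical all_reals ereal.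

Set Implicit Arguments.
Unset Strict Implicit.
Unset Printing Implicit Defensive.

Local Open Scope classical_set_scope.

(** * Terms *)

(* The variables are the natural numbers.  A signature is a type [F] of function
   symbols together with [ar : F -> nat]; [Fun] itself does not enforce arities,
   and [wt ar t] says that [t] is a term over the signature. *)
Inductive term (F : Type) : Type :=
| Var of nat
| Fun of F & seq (term F).
Arguments Var {F} _.

Fixpoint wt (F : Type) (ar : F -> nat) (t : term F) : bool :=
  match t with
  | Var _ => true
  | Fun f ts => (size ts == ar f) && all (wt ar) ts
  end.

(* Variable occurrences, from left to right. *)
Fixpoint vars (F : Type) (t : term F) : seq nat :=
  match t with
  | Var x => [:: x]
  | Fun _ ts => flatten (map (@vars F) ts)
  end.

Definition ground (F : Type) (t : term F) : bool := nilp (vars t).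

(* |t| : all symbol occurrences, variables included. *)
Fixpoint term_size (F : Type) (t : term F) : nat :=
  match t with
  | Var _ => 1
  | Fun _ ts => (sumn (map (@term_size F) ts)).+1
  end.

(* ||t|| : occurrences of function symbols only. *)
Fixpoint fsize (F : Type) (t : term F) : nat :=
  match t with
  | Var _ => 0
  | Fun _ ts => (sumn (map (@fsize F) ts)).+1
  end.

Fixpoint subst (F : Type) (s : nat -> term F) (t : term F) : term F :=
  match t with
  | Var x => s x
  | Fun f ts => Fun f (map (subst s) ts)
  end.

Fixpoint map_sym (F G : Type) (h : F -> G) (t : term F) : term G :=
  match t with
  | Var x => Var x
  | Fun f ts => Fun (h f) (map (map_sym h) ts)
  end.

Definition pos := seq nat.

Fixpoint subterm_at (F : Type) (t : term F) (p : pos) : option (term F) :=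
  match p, t with
  | [::], _ => Some t
  | i :: q, Fun _ ts => obind (fun u => subterm_at u q) (onth ts i)
  | _ :: _, Var _ => None
  end.

(* Only meaningful when [p] is a position of [t]. *)
Fixpoint replace_at (F : Type) (t : term F) (p : pos) (u : term F) : term F :=
  match p, t with
  | [::], _ => u
  | i :: q, Fun f ts =>
      Fun f (set_nth (Var 0) ts i (replace_at (nth (Var 0) ts i) q u))
  | _ :: _, Var _ => t
  end.

Definition fun_at (F : Type) (t : term F) (p : pos) : option F :=
  if subterm_at t p is Some (Fun f _) then Some f else None.

(** * Rewriting *)

Definition rule (F : Type) : Type := (term F * term F)%type.

Definition is_rule (F : Type) (ar : F -> nat) (rl : rule F) : Prop :=
  [/\ wt ar rl.1, wt ar rl.2, (forall x, rl.1 <> Var x)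
    & {subset vars rl.2 <= vars rl.1}].

Definition linear_trs (F : Type) (T : set (rule F)) : Prop :=
  forall rl, T rl -> uniq (vars rl.1) /\ uniq (vars rl.2).

Definition nonduplicating (F : Type) (T : set (rule F)) : Prop :=
  forall rl, T rl ->
    forall x, count_mem x (vars rl.2) <= count_mem x (vars rl.1).

Definition collapsing (F : Type) (T : set (rule F)) : Prop :=
  exists rl x, T rl /\ rl.2 = Var x.

Definition rstep (F : Type) (T : set (rule F)) (s t : term F) : Prop :=
  exists l r p sigma,
    [/\ T (l, r), subterm_at s p = Some (subst sigma l)
      & t = replace_at s p (subst sigma r)].

Definition star (A : Type) (R : A -> A -> Prop) : A -> A -> Prop :=
  Relation_Operators.clos_refl_trans A R.

Definition comp_rel (A : Type) (R S : A -> A -> Prop) (x z : A) : Prop :=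
  exists y, R x y /\ S y z.

Fixpoint pow_rel (A : Type) (n : nat) (R : A -> A -> Prop) : A -> A -> Prop :=
  if n is m.+1 then comp_rel R (pow_rel m R) else eq.

Definition modulo (A : Type) (RA RB : A -> A -> Prop) : A -> A -> Prop :=
  comp_rel (star RB) (comp_rel RA (star RB)).

(* The rewrite relation of the relative TRS A/B. *)
Definition rel_step (F : Type) (A B : set (rule F)) : term F -> term F -> Prop :=
  modulo (rstep A) (rstep B).

Definition Succ (F : Type) (R : term F -> term F -> Prop) (L : set (term F)) :
    set (term F) :=
  [set t | ground t /\ exists2 s, L s & star R s t].

(** * Symbols annotated with heights *)

(* [(f, c)] is the symbol f_c. *)
Definition annot (F : Type) : Type := (F * nat)%type.

Definition base (F : Type) (t : term (annot F)) : term F := map_sym fst t.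

Definition lift_to (F : Type) (c : nat) (t : term F) : term (annot F) :=
  map_sym (fun f => (f, c)) t.

(* The heights of the symbols t(p), p in FPos(t) (= FPos(base t)). *)
Definition heights (F : Type) (t : term (annot F)) : set nat :=
  [set h | exists p f, fun_at t p = Some (f, h)].

Definition is_min (A : set nat) (m : nat) : Prop :=
  A m /\ forall k, A k -> m <= k.

Definition match_trs (F : Type) (A : set (rule F)) : set (rule (annot F)) :=
  [set rl | exists l r l' m,
     [/\ A (l, r), base l' = l, is_min (heights l') m
       & rl = (l', lift_to m.+1 r)]].

Definition MATCHRT (F : Type) (c : nat) (B : set (rule F)) :
    set (rule (annot F)) :=
  [set rl | exists l' r f h d,
     let flat := fsize r <= fsize (base l') /\ lift_to h (base l') = l' in
     [/\ B (base l', r), fun_at l' [::] = Some (f, h),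
         flat -> d = minn c h,
         ~ flat -> is_min ([set c] `|` [set k.+1 | k in heights l']) d
       & rl = (l', lift_to d r)]].

Definition Raise (F : Type) (ar : F -> nat) : set (rule (annot F)) :=
  [set rl | exists f c, let xs := map Var (iota 0 (ar f)) in
     rl = (Fun (f, c) xs, Fun (f, c.+1) xs)].

(* [u] is the least common Raise-reduct of the terms in [A]. *)
Definition is_raise_lub (F : Type) (ar : F -> nat) (A : set (term (annot F)))
    (u : term (annot F)) : Prop :=
  let above v := forall s, A s -> star (rstep (Raise ar)) s v in
  above u /\ forall v, above v -> star (rstep (Raise ar)) u v.

(* The step s ~>_T t.  A context C with n holes and no variables is encoded as a
   term whose variable occurrences are, from left to right, 0, ..., n-1; then
   C[s_1, ..., s_n] is the result of substituting s_(i+1) for i. *)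
Definition raise_step (F : Type) (ar : F -> nat) (T : set (rule (annot F)))
    (s t : term (annot F)) : Prop :=
  exists l r p (C : term (annot F)) (xs : seq nat) (ss : seq (term (annot F)))
      (sigma : nat -> term (annot F)),
    let x i := nth 0 xs i in
    let u i := nth (Var 0) ss i in
    let n := size xs in
    [/\ [/\ T (l, r), vars C = iota 0 n & size ss = n],
        l = subst (fun i => Var (x i)) C /\
          subterm_at s p = Some (subst u C),
        (forall i j, i < n -> j < n -> x i = x j -> base (u i) = base (u j)),
        (forall i, i < n ->
           is_raise_lub ar [set u j | j in [set j | j < n /\ x j = x i]]
             (sigma (x i)))
      & t = replace_at s p (subst sigma r)].

Definition bounded_by (F : Type) (c : nat) (K : set (term (annot F))) : Prop :=
  forall t, K t -> forall h, heights t h -> h <= c.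

Definition match_RT_bounded (F : Type) (A B : set (rule F)) (L : set (term F)) :
    Prop :=
  exists c, bounded_by c
    (Succ (rel_step (match_trs A) (MATCHRT c B)) (lift_to 0 @` L)).

Definition match_raise_RT_bounded (F : Type) (ar : F -> nat)
    (A B : set (rule F)) (L : set (term F)) : Prop :=
  exists c, bounded_by c
    (Succ (modulo (raise_step ar (match_trs A)) (raise_step ar (MATCHRT c B)))
       (lift_to 0 @` L)).

(** * Complexity *)

Section Complexity.
Variable K : realType.
Local Open Scope ring_scope.
Local Open Scope ereal_scope.

(* Suprema are taken in the natural numbers extended with infinity, viewed inside
   [\bar K]; joining [0] makes the supremum of the empty set 0 rather than -oo. *)
Definition dl (A : Type) (t : A) (R : A -> A -> Prop) : \bar K :=
  ereal_sup [set (m%:R)%:E | m in [set m | exists u, pow_rel m R t u]].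

Definition cp (F : Type) (n : nat) (R : term F -> term F -> Prop)
    (L : set (term F)) : \bar K :=
  ereal_sup ([set 0] `|` [set dl t R | t in [set t | L t /\ (term_size t <= n)%N]]).

Definition bigO (g h : nat -> \bar K) : Prop :=
  exists (C : K) (N : nat),
    (0 < C)%R /\ forall n, (N <= n)%N -> g n <= C%:E * h n.

End Complexity.

(* The problem (strict/weak, lang); see [is_cp_problem] for well-formedness. *)
Record cp_problem (F : Type) : Type := CPProblem {
  strict : set (rule F);
  weak : set (rule F);
  lang : set (term F) }.

HB.instance Definition _ (F : Type) := gen_eqMixin (cp_problem F).
HB.instance Definition _ (F : Type) := gen_choiceMixin (cp_problem F).

Definition is_trs (F : Type) (ar : F -> nat) (T : set (rule F)) : Prop :=
  finite_set T /\ forall rl, T rl -> is_rule ar rl.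

Definition is_cp_problem (F : Type) (ar : F -> nat) (P : cp_problem F) : Prop :=
  [/\ is_trs ar (strict P), is_trs ar (weak P)
    & forall t, lang P t -> wt ar t].

Definition is_ground_cp_problem (F : Type) (ar : F -> nat) (P : cp_problem F) :
    Prop :=
  is_cp_problem ar P /\ forall t, lang P t -> ground t.

Definition cp_of (K : realType) (F : Type) (P : cp_problem F) (n : nat) :
    \bar K :=
  cp K n (rel_step (strict P) (weak P)) (lang P).

Definition triple (F : Type) : Type := (cp_problem F * (nat -> nat))%type.

(* Processors with domain [D]; outside [D] the value of [Phi] is irrelevant. *)
Definition cp_processor (F : Type) (ar : F -> nat) (D : set (cp_problem F))
    (Phi : cp_problem F -> set (triple F)) : Prop :=
  forall P, D P ->
    finite_set (Phi P) /\ forall q, Phi P q -> is_cp_problem ar q.1.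

Definition sound (K : realType) (F : Type) (D : set (cp_problem F))
    (Phi : cp_problem F -> set (triple F)) : Prop :=
  forall P, D P ->
    bigO (cp_of K P)
      (fun n => \sum_(q \in Phi P) ((q.2 n)%:R%R : K)%:E
                + \sum_(q \in Phi P) cp_of K q.1 n)%E.

(** * The splits considered by the processor *)

Definition match_split (F : Type) (ar : F -> nat) (P : cp_problem F)
    (R1 R2 : set (rule F)) : Prop :=
  let B := R1 `|` weak P in
  [/\ strict P = R1 `|` R2, ~ collapsing R2
    & linear_trs (R2 `|` B) /\ match_RT_bounded R2 B (lang P)
      \/ nonduplicating (R2 `|` B) /\
         match_raise_RT_bounded ar R2 B (lang P)].

(* Main.v *)
(* A derivation of R2/(R1 u S) from a ground term t is lifted step by step, from
   lift_0(t), to a derivation of matchRT (with joins at non-linear variables),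
   whose heights stay below the bound c.  Let K bound the size of all right-hand
   sides; give a symbol of height h < c the weight (K+1)^(c-h-1), and height c
   the weight 0.  A match step removes a symbol of height m < c and creates at
   most K symbols, of height m+1, so it decreases the total weight; a MATCHRT
   step does not increase it, and neither does joining, since the weight is
   antitone.  Hence at most a constant times |t| steps use R2, and the remaining
   strict steps are counted by the complexity of R1/(R2 u S).  Since R2 is
   non-collapsing, m+1 occurs in the reduct, whence m < c. *)

From Stdlib Require Import Relation_Operators.
Require Import Defs.
From mathcomp Require Import all_boot all_order all_algebra.
From mathcomp Require Import all_classical all_reals ereal.
From mathcomp Require Import zify.

Local Open Scope classical_set_scope.
Set Implicit Arguments.
Unset Strict Implicit.
Unset Printing Implicit Defensive.
Import Order.TTheory GRing.Theory Num.Theory.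

Local Notation Fun := Defs.Fun.

Lemma cat_inj (T : Type) (a b c d : seq T) :
  size a = size c -> a ++ b = c ++ d -> a = c /\ b = d.
Proof. by elim: a c => [|x a IH] [|y c] //= [/IH H] [-> /H[-> ->]]. Qed.

(** * Induction, positions, substitution and groundness of terms *)

Section Terms.
Variable F : Type.
Implicit Types (s t u v : term F) (ts : seq (term F)).

(** The generated principle gives no hypothesis for the arguments of [Fun]. The conjunction is a
    [foldr], so that an inner induction on the argument list consumes it one argument at a time. *)
Lemma term_nested_ind (P : term F -> Prop) :
  (forall x, P (Var x)) ->
  (forall f ts, foldr (fun t => and (P t)) True ts -> P (Fun f ts)) ->
  forall t, P t.
Proof.
move=> PV PF; fix IH 1 => -[x|f ts]; first exact: PV.
by apply: PF; elim: ts => //= t ts IHts; split.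
Qed.

Lemma subterm_at_cons f ts i p u : subterm_at (Fun f ts) (i :: p) = Some u ->
  exists a t b, [/\ ts = a ++ t :: b, subterm_at t p = Some u &
    forall v, replace_at (Fun f ts) (i :: p) v =
              Fun f (a ++ replace_at t p v :: b)].
Proof.
rewrite /=; elim: ts i => [|t ts IH] [|i] //= Ht.
  by exists [::], t, ts.
have [a [t' [b [-> Ht' Hr]]]] := IH i Ht.
exists (t :: a), t', b; split=> // v.
by have [->] := Hr v.
Qed.

(** Induction over one-hole contexts: groundness, height lists and the raise order are all carried
    from a redex to the whole term this way. *)
Lemma replace_at_ind (Q : term F -> term F -> Prop) u v : Q u v ->
  (forall f a b s t, Q s t -> Q (Fun f (a ++ s :: b)) (Fun f (a ++ t :: b))) ->
  forall s p, subterm_at s p = Some u -> Q s (replace_at s p v).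
Proof.
move=> Quv QF s p; elim: p s => [|i p IH] [x|f ts] //.
- by case=> ->.
- by case=> ->.
by move=> /subterm_at_cons [a [t [b [-> /IH Ht ->]]]]; apply: QF.
Qed.

Lemma rstep_ctx T f a b s t : rstep T s t ->
  rstep T (Fun f (a ++ s :: b)) (Fun f (a ++ t :: b)).
Proof.
case=> l [r [p [sg [Tlr Hs ->]]]]; exists l, r, (size a :: p), sg.
split=> //=.
- by elim: a => //= _ a ->.
- by rewrite nth_cat ltnn subnn /= set_nthE size_cat /= addnS ltnS leq_addr
    take_size_cat // drop_cat ltnNge leqnSn subSnn /= drop0.
Qed.

Lemma subst_eq_in sg tau t : {in vars t, sg =1 tau} -> subst sg t = subst tau t.
Proof.
elim/term_nested_ind: t => [x|f ts IH] /= E; first by apply: E; rewrite inE.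
congr Fun; elim: ts IH E => //= t ts IHts [Ht Hts] E.
congr cons; first by apply: Ht => x xt; apply: E; rewrite mem_cat xt.
by apply: IHts => // x xt; apply: E; rewrite mem_cat xt orbT.
Qed.

Lemma subst_Var (X : nat -> nat) sg t :
  subst sg (subst (fun i => Var (X i)) t) = subst (fun i => sg (X i)) t.
Proof.
elim/term_nested_ind: t => [x|f ts IH] //=.
by congr Fun; elim: ts IH => //= t ts IHts [-> /IHts ->].
Qed.

Lemma vars_map_sym G (h : F -> G) t : vars (map_sym h t) = vars t.
Proof.
elim/term_nested_ind: t => [x|f ts IH] //=.
by elim: ts IH => //= t ts IHts [-> /IHts ->].
Qed.

(** Groundness and respect of arities are merged into one recursion, so that a single invariant
    passes through subterms, substitution and replacement. *)
Fixpoint ground_wt (ar : F -> nat) t : bool :=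
  if t is Fun f ts then (size ts == ar f) && all (ground_wt ar) ts else false.

Lemma ground_wtE ar t : ground_wt ar t = wt ar t && ground t.
Proof.
elim/term_nested_ind: t => [x|f ts IH] //=.
rewrite -andbA; congr andb; rewrite /ground /=.
elim: ts IH => //= t ts IHts [-> /IHts ->].
by rewrite /ground /nilp size_cat addn_eq0 andbACA.
Qed.

Lemma ground_wt_subst ar sg t :
  wt ar t -> {in vars t, forall x, ground_wt ar (sg x)} ->
  ground_wt ar (subst sg t).
Proof.
elim/term_nested_ind: t => [x|f ts IH] /=.
  by move=> _; apply; rewrite inE.
rewrite size_map => /andP[-> /=]; elim: ts IH => //= t ts IHts [Ht Hts].
move=> /andP[wt1 wt2] E; apply/andP; split.
  by apply: Ht => // x xt; apply: E; rewrite mem_cat xt.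
by apply: IHts => // x xt; apply: E; rewrite mem_cat xt orbT.
Qed.

Lemma ground_wt_substW ar sg t x :
  ground_wt ar (subst sg t) -> x \in vars t -> ground_wt ar (sg x).
Proof.
elim/term_nested_ind: t => [y|f ts IH] /=; first by rewrite inE => + /eqP ->.
move=> /andP[_]; elim: ts IH => //= t ts IHts [Ht Hts] /andP[wt1 wt2].
by rewrite mem_cat => /orP[/(Ht wt1)|/(IHts Hts wt2)].
Qed.

Lemma ground_wt_subterm ar s p u :
  subterm_at s p = Some u -> ground_wt ar s -> ground_wt ar u.
Proof.
elim: p s => [|i p IH] [x|f ts] //; try by case=> <-.
move=> /subterm_at_cons[a [t [b [-> /IH Ht _]]]] /= /andP[_].
by rewrite all_cat /= => /and3P[_ /Ht].
Qed.

Lemma ground_wt_replace ar s p u v : subterm_at s p = Some u ->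
  ground_wt ar v -> ground_wt ar s -> ground_wt ar (replace_at s p v).
Proof.
move=> Hs gv; set Q := fun s t => ground_wt ar s -> ground_wt ar t.
apply: (replace_at_ind (Q := Q)) Hs => // f a b s' t' IH; rewrite /Q /=.
by rewrite !size_cat !all_cat /= => /and4P[-> -> /IH -> ->].
Qed.

Lemma ground_wt_rstep ar T s t : (forall rl, T rl -> is_rule ar rl) ->
  rstep T s t -> ground_wt ar s -> ground_wt ar t.
Proof.
move=> HT [l [r [p [sg [Tlr Hs ->]]]]] gs.
have [/= _ wr _ sub] := HT _ Tlr.
apply: (ground_wt_replace Hs) => //.
have gl := ground_wt_subterm Hs gs.
by apply: ground_wt_subst => // x /sub; apply: ground_wt_substW.
Qed.

End Terms.

(** * Heights of annotated terms *)

Section Annotated.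
Variable F : Type.
Implicit Types (s t u v : term (annot F)).

(** Unlike the set [heights], this preorder list keeps multiplicities, which the weights need;
    together with the base it determines the term. *)
Fixpoint height_seq t : seq nat :=
  if t is Fun f ts then f.2 :: flatten (map height_seq ts) else [::].

Lemma heightsP t h : heights t h <-> h \in height_seq t.
Proof.
elim/term_nested_ind: t => [x|[f k] ts IH]; split.
- by case=> -[|i p] [].
- by [].
- case=> -[|i p] [g] /=; first by case=> _ <-; rewrite inE eqxx.
  rewrite /fun_at /= inE => H; apply/orP; right.
  elim: ts i IH H => [|t ts IHts] [|i] //= [Ht Hts] H; rewrite mem_cat.
    by apply/orP; left; apply/Ht; exists p, g.
  by rewrite (IHts i) // orbT.
rewrite inE => /orP[/eqP->|]; first by exists [::], f.
move=> H; suff [i [p [g Hg]]] : exists i p g,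
    obind (fun u => fun_at u p) (onth ts i) = Some (g, h).
  exists (i :: p), g; rewrite /fun_at /= -Hg.
  by case: (onth ts i).
elim: ts IH H => //= t ts IHts [Ht Hts]; rewrite mem_cat.
case/orP=> [/Ht[p [g Hg]]|].
  by exists 0, p, g.
by move=> /(IHts Hts)[i [p [g Hg]]]; exists i.+1, p, g.
Qed.

Lemma size_height_seq t : size (height_seq t) = fsize (base t).
Proof.
elim/term_nested_ind: t => [x|f ts IH] //=; congr S.
by elim: ts IH => //= t ts IHts [Ht Hts]; rewrite size_cat Ht IHts.
Qed.

Lemma height_seq_lift c (t : term F) :
  height_seq (lift_to c t) = nseq (fsize t) c.
Proof.
elim/term_nested_ind: t => [x|f ts IH] //=; congr cons.
elim: ts IH => //= t ts IHts [Ht Hts].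
by rewrite -/(lift_to c t) Ht IHts // nseqD.
Qed.

Lemma base_lift c (t : term F) : base (lift_to c t) = t.
Proof.
elim/term_nested_ind: t => [x|f ts IH] //=; congr Fun.
by elim: ts IH => //= t ts IHts [Ht Hts]; congr cons; [exact: Ht | exact: IHts].
Qed.

Lemma base_subst (sg : nat -> term (annot F)) t :
  base (subst sg t) = subst (fun x => base (sg x)) (base t).
Proof.
elim/term_nested_ind: t => [x|f ts IH] //=; congr Fun.
by elim: ts IH => //= t ts IHts [Ht Hts]; congr cons; [exact: Ht | exact: IHts].
Qed.

Lemma subterm_at_base t p :
  subterm_at (base t) p = omap (@base F) (subterm_at t p).
Proof.
elim: p t => [|i p IH] [x|f ts] //=; rewrite onth_map.
by case: (onth ts i) => //=.
Qed.

Lemma replace_at_base t p u v : subterm_at t p = Some u ->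
  base (replace_at t p v) = replace_at (base t) p (base v).
Proof.
elim: p t => [|i p IH] [x|f ts] //=.
elim: ts i => [|t ts IHts] [|i] //= Ht; first by rewrite -(IH t).
by case: (IHts i Ht) => H; congr (Fun _ (_ :: _)); exact: H.
Qed.

(** Only a permutation, since in preorder the substituted terms are interleaved with the symbols of
    [t]; sums and bounds on heights do not see the order. *)
Lemma height_seq_subst sg t : perm_eq (height_seq (subst sg t))
  (height_seq t ++ flatten [seq height_seq (sg x) | x <- vars t]).
Proof.
elim/term_nested_ind: t => [x|f ts IH] /=; first by rewrite cats0.
rewrite perm_cons; elim: ts IH => //= t ts IHts [Ht Hts].
rewrite map_cat flatten_cat; apply: perm_trans (perm_cat Ht (IHts Hts)) _.
by rewrite -!catA perm_cat2l perm_catCA.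
Qed.

(** Adding the removed heights on the left avoids a subtraction of multisets. *)
Lemma height_seq_replace s p u v : subterm_at s p = Some u ->
  perm_eq (height_seq (replace_at s p v) ++ height_seq u)
          (height_seq s ++ height_seq v).
Proof.
move=> Hs; set Q := fun s t => perm_eq (height_seq t ++ height_seq u)
          (height_seq s ++ height_seq v).
apply: (replace_at_ind (Q := Q)) Hs => [|f a b s' t' IH].
  by rewrite /Q perm_catC.
rewrite /Q /= perm_cons !map_cat !flatten_cat /= -!catA perm_cat2l.
by rewrite perm_catCA perm_sym perm_catCA perm_cat2l perm_sym.
Qed.

Lemma height_seq_replace_sub s p u v : subterm_at s p = Some u ->
  {subset height_seq v <= height_seq (replace_at s p v)}.
Proof.
set Q := fun (_ t : term (annot F)) => {subset height_seq v <= height_seq t}.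
move=> Hs; apply: (replace_at_ind (Q := Q)) Hs => // f a b s' t' IH h hv.
by rewrite /= inE map_cat flatten_cat /= !mem_cat (IH h hv) !orbT.
Qed.

Lemma all_heights_subterm c s p u : subterm_at s p = Some u ->
  all (geq c) (height_seq s) -> all (geq c) (height_seq u).
Proof.
elim: p s => [|i p IH] [x|f ts] //; [by move=> [<-] | by move=> [<-] |].
move=> Hs; have [a [t [b [-> /IH Ht _]]]] := subterm_at_cons Hs.
move=> /= /andP[_].
by rewrite map_cat flatten_cat /= !all_cat => /and3P[_ /Ht].
Qed.

(** With [annot_inj], annotated terms correspond to pairs of a base and a height list of the right
    length, so a join can be built from its list of heights. *)
Lemma annotate (t : term F) hs : size hs = fsize t ->
  exists t', base t' = t /\ height_seq t' = hs.
Proof.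
elim/term_nested_ind: t hs => [x|f ts IH] [|h hs] //=; first by exists (Var x).
case; suff H : size hs = sumn (map (@fsize F) ts) -> exists ts',
    map (@base F) ts' = ts /\ flatten (map height_seq ts') = hs.
  by move=> /H[ts' [<- <-]]; exists (Fun (f, h) ts').
elim: ts hs IH => [|t ts IHts] hs /=; first by case: hs => // _ _; exists [::].
move=> [Ht Hts] Hsz.
have [|t' [Eb Et']] := Ht (take (fsize t) hs).
  by rewrite size_takel // Hsz leq_addr.
have [||ts' [<- Ets']] := IHts (drop (fsize t) hs) => //.
  by rewrite size_drop Hsz addKn.
by exists (t' :: ts'); rewrite /= Eb Et' Ets' cat_take_drop.
Qed.

Lemma annot_inj s t : base s = base t -> height_seq s = height_seq t -> s = t.
Proof.
elim/term_nested_ind: s t => [x|[f h] ss IH] [y|[g k] ts] //=.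
  by case=> ->.
case=> -> Eb [-> Eh]; congr Fun.
elim: ss ts IH Eb Eh => [|s ss IHss] [|t ts] //= [Hs Hss] [Eb Ebs] Eh.
have sz : size (height_seq s) = size (height_seq t).
  by rewrite !size_height_seq /base Eb.
case: (cat_inj sz Eh) => E1 E2; congr cons; [exact: Hs | exact: IHss].
Qed.

(** * The raise order as a pointwise comparison of heights *)

Definition raise_le s t :=
  base s = base t /\ all2 leq (height_seq s) (height_seq t).

Lemma all2_cat (T : Type) (r : T -> T -> bool) (a b c d : seq T) :
  size a = size c -> all2 r (a ++ b) (c ++ d) = all2 r a c && all2 r b d.
Proof. by elim: a c => [|x a IH] [|y c] //= [/IH ->]; rewrite andbA. Qed.

Lemma all2_leq_refl hs : all2 leq hs hs.
Proof. by elim: hs => //= h hs ->; rewrite leqnn. Qed.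

Lemma raise_le_refl t : raise_le t t.
Proof. by split=> //; apply: all2_leq_refl. Qed.

Lemma raise_le_trans s t u : raise_le s t -> raise_le t u -> raise_le s u.
Proof.
rewrite /raise_le => -[-> H1] [-> H2]; split=> //.
elim: (height_seq s) (height_seq t) (height_seq u) H1 H2
  => [|a x IH] [|b y] [|c z] //=.
by move=> /andP[ab /IH H] /andP[bc /H ->]; rewrite (leq_trans ab bc).
Qed.

Lemma star_raise_le ar s t : star (rstep (Raise ar)) s t -> raise_le s t.
Proof.
elim=> [{}s {}t|{}s|{}s t' {}t _ + _]; last exact: raise_le_trans.
  case=> l [r [p [sg [[f [c [-> ->]]] Hs ->]]]].
  apply: (replace_at_ind (Q := raise_le)) Hs => [|{}f a b {}s {}t [Eb Eh]].
    by split=> //=; rewrite leqnSn all2_leq_refl.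
  split; first by move: Eb; rewrite /base /= !map_cat /= => ->.
  rewrite /= leqnn !map_cat !flatten_cat /= all2_cat // all2_leq_refl /=.
  by rewrite all2_cat ?Eh ?all2_leq_refl // !size_height_seq Eb.
exact: raise_le_refl.
Qed.

Lemma star_ctx T f a b s t : star (rstep T) s t ->
  star (rstep T) (Fun f (a ++ s :: b)) (Fun f (a ++ t :: b)).
Proof.
elim=> [{}s {}t st|{}s|{}s t' {}t _ + _]; last exact: rt_trans.
  by apply: rt_step; apply: rstep_ctx.
exact: rt_refl.
Qed.

(** Converse of [star_raise_le]: raise the root one level at a time, then the arguments from left to
    right. *)
Lemma raise_le_star ar s t : ground_wt ar (base s) -> raise_le s t ->
  star (rstep (Raise ar)) s t.
Proof.
elim/term_nested_ind: s t => [x|[f h] ss IH] [y|[g k] ts] //.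
  by move=> _ [].
move=> /= /andP[/eqP sz gss] [/= [<- Eb] /andP[hk Eh]].
apply: (@rt_trans _ _ _ (Fun (f, k) ss)).
  rewrite -(subnK hk); elim: (k - h) => [|m IHm]; first exact: rt_refl.
  apply: rt_trans IHm _; apply: rt_step.
  pose l n : term (annot F) := Fun (f, n) [seq Var i | i <- iota 0 (ar f)].
  (* A [Raise] rule has exactly [ar f] variables, so matching it against the root needs the arity of
     [f] to be respected. *)
  have El n : subst (nth (Var 0) ss) (l n) = Fun (f, n) ss.
    rewrite /= -map_comp; congr Fun; rewrite size_map in sz.
    by rewrite -[RHS](mkseq_nth (Var 0)) sz.
  exists (l (m + h)), (l (m.+1 + h)), [::], (nth (Var 0) ss).
  by split; rewrite ?El //; exists f, (m + h).
have -> : ss = [::] ++ ss by []; have -> : ts = [::] ++ ts by [].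
(* The empty prefix is generalised to the list [a] of arguments already raised. *)
move: {sz hk} [::] => a.
elim: ss ts a IH gss Eb Eh => [|s ss IHss] [|t ts] a //=.
  by move=> *; apply: rt_refl.
move=> [Hs Hss] /andP[gs gss] [Eb Ebs]; rewrite all2_cat; last first.
  by rewrite !size_height_seq /base Eb.
move=> /andP[Eh Ehs]; apply: (@rt_trans _ _ _ (Fun (f, k) (a ++ t :: ss))).
  by apply: star_ctx; apply: Hs.
by rewrite -!cat_rcons; apply: IHss.
Qed.

End Annotated.

(** * Weights, joins, and lifting a single rewrite step *)

Section Lifting.
Variable F : Type.
Implicit Types (l r t : term F) (s u v : term (annot F)).

(** [C] is the part of [u] matched by the function symbols of [l], with its heights, and [ss] lists
    the terms in its holes. Numbering the holes from an arbitrary [k] lets the contexts of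
    successive arguments be concatenated. *)
Lemma redex_context (sg : nat -> term F) l u (k : nat) : base u = subst sg l ->
  exists (C : term (annot F)) (ss : seq (term (annot F))),
    [/\ vars C = iota k (size (vars l)), map (@base F) ss = map sg (vars l),
      forall X : nat -> nat, map X (vars C) = vars l ->
        base (subst (fun i => Var (X i)) C) = l
      & forall U, map U (vars C) = ss -> subst U C = u].
Proof.
elim/term_nested_ind: l u k => [x|f ls IH] u k.
  move=> /= Eu; exists (Var k), [:: u]; split=> //=; first by rewrite Eu.
    by move=> X [->].
  by move=> U [->].
case: u => [//|[g h] us] [Eg Eus]; rewrite {g}Eg.
suff [Cs [ss [H1 H2 H3 H4]]] : exists (Cs ss : seq (term (annot F))),
    [/\ flatten (map (@vars _) Cs) = iota k (size (flatten (map (@vars _) ls))),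
      map (@base F) ss = map sg (flatten (map (@vars _) ls)),
      forall X : nat -> nat,
        map X (flatten (map (@vars _) Cs)) = flatten (map (@vars _) ls) ->
        map (fun C => base (subst (fun i => Var (X i)) C)) Cs = ls
      & forall U, map U (flatten (map (@vars _) Cs)) = ss ->
        map (subst U) Cs = us].
  exists (Fun (f, h) Cs), ss; split=> // [X /= /H3 E|U /= /H4 -> //].
  by rewrite /base /= -map_comp; congr Fun.
elim: ls us k IH Eus => [|l ls IHls] [|u us] k //=.
  by move=> _ _; exists [::], [::].
move=> [Hl Hls] [/(Hl _ k)[C [ss [H1 H2 H3 H4]]]].
move=> /(IHls _ (k + size (vars l)) Hls)[Cs [sss [Q1 Q2 Q3 Q4]]].
exists (C :: Cs), (ss ++ sss); split=> /=.
- by rewrite H1 Q1 size_cat iotaD.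
- by rewrite !map_cat H2 Q2.
- move=> X; rewrite map_cat => /cat_inj[|/H3 -> /Q3 -> //].
  by rewrite size_map H1 size_iota.
- move=> U; rewrite map_cat => /cat_inj[|/H4 -> /Q4 -> //].
  by rewrite size_map H1 size_iota -(size_map sg) -H2 size_map.
Qed.

Definition weight (w : nat -> nat) u := \sum_(h <- height_seq u) w h.

Definition antitone (w : nat -> nat) := forall i j, i <= j -> w j <= w i.

Lemma weight_subst w sg u :
  weight w (subst sg u) = weight w u + \sum_(x <- vars u) weight w (sg x).
Proof.
rewrite /weight (perm_big _ (height_seq_subst sg u)) big_cat /=; congr addn.
by rewrite big_flatten /= big_map.
Qed.

Lemma weight_raise_le w u v : antitone w -> raise_le u v ->
  weight w v <= weight w u.
Proof.
move=> Hw [_]; rewrite /weight.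
elim: (height_seq u) (height_seq v) => [|a x IH] [|b y] //=.
by move=> /andP[ab /IH H]; rewrite !big_cons leq_add // Hw.
Qed.

Lemma all_heights_subst c sg u : all (geq c) (height_seq (subst sg u)) =
  all (geq c) (height_seq u) &&
  all (fun x => all (geq c) (height_seq (sg x))) (vars u).
Proof.
rewrite (perm_all _ (height_seq_subst sg u)) all_cat; congr andb.
by elim: (vars u) => //= x xs IH; rewrite all_cat IH.
Qed.

Lemma all2_leqP (a b : seq nat) : all2 leq a b <->
  size a = size b /\ forall i, i < size b -> nth 0 a i <= nth 0 b i.
Proof.
elim: a b => [|x a IH] [|y b] //=; try by split=> // -[].
split=> [/andP[xy /IH[-> H]]|[[E] H]]; first by split=> // -[|i] //; apply: H.
by rewrite (H 0) //=; apply/IH; split=> // i; apply: (H i.+1).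
Qed.

(** As all bases agree, the join is the common base with the maximal height at each symbol. Maxima
    keep any upper bound [c], and the join of a single term is that term, which serves the linear
    case. *)
Lemma raise_lub_exists ar n (us : seq (term (annot F))) (P : pred nat) i0 :
  i0 < n -> P i0 ->
  ground_wt ar (base (nth (Var 0) us i0)) ->
  (forall i, i < n -> P i ->
     base (nth (Var 0) us i) = base (nth (Var 0) us i0)) ->
  exists v, [/\ is_raise_lub ar
      [set nth (Var 0) us j | j in [set j | j < n /\ P j]] v,
    base v = base (nth (Var 0) us i0),
    forall i, i < n -> P i -> raise_le (nth (Var 0) us i) v,
    forall c, (forall i, i < n -> P i ->
        all (geq c) (height_seq (nth (Var 0) us i))) ->
      all (geq c) (height_seq v)
    & (forall i, i < n -> P i -> i = i0) -> v = nth (Var 0) us i0].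
Proof.
move=> i0n Pi0 g0 Eb; set u := nth (Var 0) us.
set N := fsize (base (u i0)).
pose hs := mkseq (fun k => \max_(i < n | P i) nth 0 (height_seq (u i)) k) N.
have [v [Ev Hv]] := annotate (t := base (u i0)) (hs := hs) (size_mkseq _ _).
have szu i : i < n -> P i -> size (height_seq (u i)) = N.
  by move=> ni Pi; rewrite size_height_seq Eb.
have lev i : i < n -> P i -> raise_le (u i) v.
  move=> ni Pi; split; first by rewrite Ev Eb.
  apply/all2_leqP; rewrite Hv size_mkseq szu //; split=> // k kN.
  rewrite nth_mkseq //.
  pose f (i : 'I_n) := nth 0 (height_seq (u i)) k.
  exact: (leq_bigmax_cond (F := f) (Ordinal ni)).
have vle v' : (forall i, i < n -> P i -> raise_le (u i) v') -> raise_le v v'.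
  move=> H; have [Ev' _] := H _ i0n Pi0; split; first by rewrite Ev Ev'.
  have szv' : size (height_seq v') = N by rewrite size_height_seq -Ev'.
  apply/all2_leqP; rewrite Hv size_mkseq szv'; split=> // k kN.
  rewrite nth_mkseq //; apply/bigmax_leqP => i Pi.
  by have [_ /all2_leqP[_]] := H i (ltn_ord i) Pi; apply; rewrite szv'.
exists v; split=> //.
- split=> [_ [i [ni Pi] <-]|v' H].
    by apply: raise_le_star; [rewrite Eb | apply: lev].
  apply: raise_le_star; first by rewrite Ev.
  by apply: vle => i ni Pi; apply: (@star_raise_le _ ar); apply: H; exists i.
- move=> c H; rewrite Hv all_map; apply/allP => k; rewrite mem_iota /= => kN.
  apply/bigmax_leqP => i Pi; apply: (allP (H i (ltn_ord i) Pi)).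
  by apply: mem_nth; rewrite szu.
- move=> H; apply: annot_inj => //; rewrite Hv.
  apply: (@eq_from_nth _ 0); rewrite size_mkseq ?szu // => k kN.
  rewrite nth_mkseq // (big_pred1 (Ordinal i0n)) // => i /=.
  apply/idP/eqP => [Pi|->]; last exact: Pi0.
  by apply: val_inj; exact: (H i (ltn_ord i) Pi).
Qed.

(** Up to permutation [a] is a subsequence of [b], and dropping summands cannot increase the sum. *)
Lemma leq_big_count (a b : seq nat) (g : nat -> nat) :
  (forall x, count_mem x a <= count_mem x b) ->
  \sum_(x <- a) g x <= \sum_(x <- b) g x.
Proof.
move=> /count_subseqP[_ /subseqP[m _ ->] Hp]; rewrite (perm_big _ Hp).
elim: b m {Hp} => [|x b IH] [|[] m]; rewrite ?mask0 ?big_nil //= ?big_cons.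
  by rewrite leq_add2l.
exact: leq_trans (IH m) (leq_addl _ _).
Qed.


(* [tau] maps a variable to the join of the terms at its occurrences. *)
Lemma lift_redex ar (sg : nat -> term F) l u :
  ground_wt ar (base u) -> base u = subst sg l ->
  exists (l' : term (annot F)) (tau : nat -> term (annot F)), [/\ base l' = l,
    {in vars l, forall x, base (tau x) = sg x},
    forall w, antitone w ->
      weight w l' + \sum_(x <- vars l) weight w (tau x) <= weight w u,
    forall c, all (geq c) (height_seq u) -> all (geq c) (height_seq l') /\
      {in vars l, forall x, all (geq c) (height_seq (tau x))}
    & (uniq (vars l) -> subst tau l' = u) /\
      forall T s p (r : term (annot F)), T (l', r) -> subterm_at s p = Some u ->
        raise_step ar T s (replace_at s p (subst tau r))].
Proof.
move=> gu Eu; have [C [ss [HC Hss HX HU]]] := redex_context 0 Eu.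
set xs := vars l in HC Hss HX *; set n := size xs.
pose X i := nth 0 xs i; pose U i := nth (Var 0) ss i.
have szss : size ss = n by rewrite -(size_map (@base F)) Hss size_map.
have mapX : map X (vars C) = xs by rewrite HC; apply: mkseq_nth.
have mapU : map U (vars C) = ss by rewrite HC -/n -szss; apply: mkseq_nth.
have EC := HX _ mapX; have Eu' := HU _ mapU.
have baseU i : i < n -> base (U i) = sg (X i).
  move=> ni; rewrite -[LHS](nth_map (Var 0) (Var 0)) ?szss // Hss.
  by rewrite (nth_map 0).
have gU i : i < n -> ground_wt ar (base (U i)).
  move=> ni; rewrite baseU //; apply: (@ground_wt_substW _ ar sg l).
    by rewrite -Eu.
  exact: mem_nth.
(* The existential stands outside the membership premise, so that choice yields a total [tau];
   variables outside [l] get an arbitrary value. *)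
have lub x : exists v, x \in xs -> [/\ is_raise_lub ar
      [set U j | j in [set j | j < n /\ X j = x]] v,
    base v = sg x,
    forall i, i < n -> X i = x -> raise_le (U i) v,
    forall c, (forall i, i < n -> all (geq c) (height_seq (U i))) ->
      all (geq c) (height_seq v)
    & uniq xs -> forall i, i < n -> X i = x -> v = U i].
  have [xxs|] := boolP (x \in xs); last by exists (Var 0).
  have i0n : index x xs < n by rewrite index_mem.
  have Xi0 : X (index x xs) = x by apply: nth_index.
  have [||i ni /eqP Ei|v [H1 H2 H3 H4 H5]] :=
    @raise_lub_exists ar n ss (fun i => X i == x) _ i0n.
  - exact/eqP.
  - exact: gU.
  - by rewrite !baseU // Ei Xi0.
  exists v => _; split.
  - have <- // : [set j | j < n /\ X j == x] = [set j | j < n /\ X j = x].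
    by apply/seteqP; split=> j /= [jn /eqP].
  - by rewrite H2 baseU // Xi0.
  - by move=> i ni /eqP; apply: H3.
  - by move=> c H; apply: H4 => i ni _; apply: H.
  - move=> ux i ni Xi.
    have Hi j : j < n -> X j = x -> j = index x xs.
      move=> nj Xj; apply/eqP; rewrite -(nth_uniq 0 _ _ ux) //.
      exact/eqP/(etrans Xj (esym Xi0)).
    by rewrite (Hi i ni Xi); apply: H5 => j nj /eqP; apply: Hi.
have [tau Htau] := choice lub.
have Xxs i : i < n -> X i \in xs by apply: mem_nth.
exists (subst (fun i => Var (X i)) C), tau; split=> //.
- by move=> x /Htau[].
(* Compared hole by hole: the term in a hole lies below the join of its variable, which therefore
   weighs no more. *)
- move=> w Hw; rewrite -Eu' !weight_subst -addnA leq_add2l -mapX big_map.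
  rewrite -big_split /= big_seq [leqRHS]big_seq; apply: leq_sum => i.
  rewrite HC mem_iota add0n /= => ni.
  rewrite {1}/weight /= big_nil add0n; apply: weight_raise_le => //.
  by have [_ _ H _ _] := Htau _ (Xxs i ni); apply: H.
- move=> c; rewrite -Eu' !all_heights_subst => /andP[-> /allP H]; split.
    by apply/andP; split=> //; apply/allP.
  move=> x /Htau[_ _ _ + _]; apply=> i ni; apply: H.
  by rewrite HC mem_iota.
split=> [ux|T s p r Tlr Hs].
  rewrite subst_Var -Eu'; apply: subst_eq_in => i.
  rewrite HC mem_iota add0n /= => ni.
  by have [_ _ _ _ H] := Htau _ (Xxs i ni); apply: H.
exists (subst (fun i => Var (X i)) C), r, p, C, xs, ss, tau; split=> //.
- by split=> //; rewrite Hs Eu'.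
- by move=> i j ni nj Xij; rewrite !baseU // /X Xij.
- by move=> i ni; have [H _ _ _ _] := Htau _ (Xxs i ni).
Qed.

(** The disjunction lets one argument serve both ordinary rewriting with linear rules and raise
    steps. *)
Definition liftable_step ar (A : set (rule F))
    (step : set (rule (annot F)) -> term (annot F) -> term (annot F) -> Prop) :=
  step = @rstep (annot F) /\ linear_trs A \/ step = raise_step ar.

(** [l'] is fixed before [T] and [d], because the height [d] of the lifted rule is computed from
    [l']. In the weight estimate the step gives up [l'] and gains [fsize r] symbols of height [d];
    the substituted terms gain nothing, as no variable is duplicated. *)
Lemma lift_step ar A step (s : term (annot F)) c l r p sg :
  liftable_step ar A step -> A (l, r) -> is_rule ar (l, r) ->
  (forall x, count_mem x (vars r) <= count_mem x (vars l)) ->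
  ground_wt ar (base s) -> subterm_at (base s) p = Some (subst sg l) ->
  all (geq c) (height_seq s) ->
  exists l' : term (annot F), [/\ base l' = l, all (geq c) (height_seq l')
    & forall T d, T (l', lift_to d r) -> exists s', [/\ step T s s',
        base s' = replace_at (base s) p (subst sg r),
        d <= c -> all (geq c) (height_seq s'),
        0 < fsize r -> d \in height_seq s'
      & forall w, antitone w ->
        weight w s' + weight w l' <= weight w s + fsize r * w d]].
Proof.
move=> Hstep Alr [/= wl wr _ sub] nd gs.
rewrite subterm_at_base; case Hs: (subterm_at s p) => [u|] //= [Eu] cs.
have gu : ground_wt ar (base u).
  apply: (ground_wt_subterm (s := base s) (p := p)) => //.
  by rewrite ?subterm_at_base ?Hs.
have [l' [tau [El Htau Hw Hc [Hlin Hraise]]]] := lift_redex gu Eu.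
have cu : all (geq c) (height_seq u) := all_heights_subterm Hs cs.
have [cl ctau] := Hc _ cu.
exists l'; split=> // T d Tlr.
exists (replace_at s p (subst tau (lift_to d r))).
have Erhs : base (subst tau (lift_to d r)) = subst sg r.
  by rewrite base_subst base_lift; apply: subst_eq_in => x /sub /Htau.
have varsr : vars (lift_to d r) = vars r.
 exact: vars_map_sym.
have Hperm := height_seq_replace (subst tau (lift_to d r)) Hs.
split.
(* For a linear rule no join changes anything: [subst tau l'] is the redex itself. *)
- case: Hstep => [[-> lin]|->]; last exact: Hraise.
  have [ul _] := lin _ Alr; exists l', (lift_to d r), p, tau; split=> //.
  by rewrite Hlin.
- by rewrite (replace_at_base _ Hs) Erhs.
- move=> dc; have := perm_all (geq c) Hperm; rewrite !all_cat cs cu andbT => ->.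
  rewrite all_heights_subst height_seq_lift all_nseq /= dc orbT varsr /=.
  by apply/allP => x /sub; apply: ctau.
- move=> fr; apply: (height_seq_replace_sub Hs).
  rewrite (perm_mem (height_seq_subst _ _)) mem_cat height_seq_lift mem_nseq.
  by rewrite fr eqxx.
- move=> w Hw'; pose v := subst tau (lift_to d r).
  have E : weight w (replace_at s p v) + weight w u = weight w s + weight w v.
    by rewrite /weight -!big_cat; apply: perm_big.
  rewrite [weight w v]weight_subst varsr in E.
  have H1 := Hw w Hw'; have H2 := leq_big_count (fun x => weight w (tau x)) nd.
  have H3 : weight w (lift_to d r) = fsize r * w d.
    by rewrite /weight height_seq_lift big_nseq iter_addn_0 mulnC.
  move: E H1 H2; rewrite H3 -/v.
  move: (\sum_(x <- vars r) _) (\sum_(x <- vars l) _) (fsize r * w d) => a b e.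
  move: (weight w (replace_at s p v)) (weight w u) (weight w s) (weight w l').
  by clear; lia.
Qed.
End Lifting.

(** * Derivations with counted and uncounted steps *)

Section Derivations.
Variable X : Type.
Implicit Types (A B : X -> X -> Prop).

(** Single steps, of which only those of [A] are counted, so that one rewrite sequence can be read
    again with other steps counted. *)
Inductive derivation A B : nat -> X -> X -> Prop :=
| derivation_nil s : derivation A B 0 s s
| derivation_strict k s t u :
    A s t -> derivation A B k t u -> derivation A B k.+1 s u
| derivation_weak k s t u :
    B s t -> derivation A B k t u -> derivation A B k s u.

Lemma derivation_cat A B j k s t u :
  derivation A B j s t -> derivation A B k t u -> derivation A B (j + k) s u.
Proof.
elim=> [{}s //|{}j {}s s' {}t st _ IH /IH|{}j {}s s' {}t st _ IH /IH].
  exact: derivation_strict st.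
exact: derivation_weak st.
Qed.

Lemma derivation_star A B B' s t : (forall s t, B' s t -> B s t) ->
  star B' s t -> derivation A B 0 s t.
Proof.
move=> sub; elim=> [{}s {}t /sub st|{}s|{}s s' {}t _ H1 _ H2].
- apply: (derivation_weak st); apply: derivation_nil.
- exact: derivation_nil.
- exact: derivation_cat H1 H2.
Qed.

(** The end point may differ from [t]: weak steps after the last strict one are dropped, since zero
    steps of [modulo] cannot absorb them. *)
Lemma derivation_pow A B k s t :
  derivation A B k s t -> exists u, pow_rel k (modulo A B) s u.
Proof.
elim=> [{}s|{}k {}s s' {}t st _ [u Hu]|[|{}k] {}s s' {}t st _ [u Hu]].
- by exists s.
- exists u, s'; split=> //; exists s; split; first exact: rt_refl.
  by exists s'; split=> //; apply: rt_refl.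
- by exists s.
- have [s1 [[s2 [s'2 s21]] s1u]] := Hu.
  exists u, s1; split=> //; exists s2; split=> //.
  exact: rt_trans (rt_step _ _ _ _ st) s'2.
Qed.

End Derivations.

Lemma rstepU1 F (T T' : set (rule F)) s t : rstep T s t -> rstep (T `|` T') s t.
Proof.
by case=> l [r [p [sg [H Hs Ht]]]]; exists l, r, p, sg; split=> //; left.
Qed.

Lemma rstepU2 F (T T' : set (rule F)) s t :
  rstep T' s t -> rstep (T `|` T') s t.
Proof.
by case=> l [r [p [sg [H Hs Ht]]]]; exists l, r, p, sg; split=> //; right.
Qed.

Lemma rstepUP F (T T' : set (rule F)) s t :
  rstep (T `|` T') s t -> rstep T s t \/ rstep T' s t.
Proof.
case=> l [r [p [sg [[H|H] Hs Ht]]]]; [left|right];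
  by exists l, r, p, sg.
Qed.

(** Each strict step uses [R1] or [R2]; it is counted in one of the two readings and weak in the
    other, while steps of [S] are weak in both. *)
Lemma rel_step_pow_split F (R1 R2 S : set (rule F)) m s t :
  pow_rel m (rel_step (R1 `|` R2) S) s t ->
  exists a b, [/\ m = a + b, derivation (rstep R1) (rstep (R2 `|` S)) a s t
    & derivation (rstep R2) (rstep (R1 `|` S)) b s t].
Proof.
elim: m s => [|m IH] s /=.
  by move=> ->; exists 0, 0; split=> //; apply: derivation_nil.
move=> [s' [[s1 [Hs1 [s2 [H12 H2]]]] /IH[a [b [-> Ha Hb]]]]].
have S1 A (T : set (rule F)) u v : star (rstep S) u v ->
    derivation A (rstep (T `|` S)) 0 u v.
  by apply: derivation_star => *; apply: rstepU2.
have [H|H] := rstepUP H12.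
- exists a.+1, b; split; first by [].
  + apply: derivation_cat (S1 _ _ _ _ Hs1) _; apply: derivation_strict H _.
    exact: derivation_cat (S1 _ _ _ _ H2) Ha.
  + apply: derivation_cat (S1 _ _ _ _ Hs1) _.
    apply: derivation_weak; first exact: (rstepU1 S H).
    exact: derivation_cat (S1 _ _ _ _ H2) Hb.
- exists a, b.+1; split; first by rewrite addnS.
  + apply: derivation_cat (S1 _ _ _ _ Hs1) _.
    apply: derivation_weak; first exact: (rstepU1 S H).
    exact: derivation_cat (S1 _ _ _ _ H2) Ha.
  + apply: derivation_cat (S1 _ _ _ _ Hs1) _; apply: derivation_strict H _.
    exact: derivation_cat (S1 _ _ _ _ H2) Hb.
Qed.

(** * The weight bound on the number of strict steps *)

(* At the top height [c] the weight is 0: a MATCHRT step on a redex all of whose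
   heights are [c] may enlarge the term while staying at height [c]. *)
Definition level_weight (K c h : nat) : nat :=
  if h < c then K.+1 ^ (c - h.+1) else 0.

Lemma level_weight_antitone K c : antitone (level_weight K c).
Proof.
move=> i j ij; rewrite /level_weight; case: ltnP => // jc.
by rewrite (leq_ltn_trans ij jc) leq_pexp2l // leq_sub2l.
Qed.

(** One level up, the weight is divided by [K.+1] or drops to 0 at height [c]. *)
Lemma level_weight_lt K c h : h < c ->
  K * level_weight K c h.+1 < level_weight K c h.
Proof.
rewrite /level_weight => hc; rewrite hc; case: (ltnP h.+1 c) => hc'; last first.
  by rewrite muln0 expn_gt0.
have -> : c - h.+1 = (c - h.+2).+1 by lia.
by rewrite expnS mulSn -addn1 addnC leq_add2r expn_gt0.
Qed.

Lemma is_min_exists (A : set nat) a : A a -> exists m, is_min A m.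
Proof.
move=> Aa; have [|m Am Hm] := @ex_minnP (fun n => `[< A n >]).
  by exists a; apply/asboolP.
by exists m; split; [apply/asboolP|move=> k /asboolP; apply: Hm].
Qed.

Lemma leq_weight F w (u : term (annot F)) h :
  h \in height_seq u -> w h <= weight w u.
Proof. by move=> hu; rewrite /weight (big_rem _ hu) leq_addr. Qed.

(** Induction along the derivation, carrying a lifted term [s']. Boundedness speaks only of terms
    reached by full [modulo] steps, so the invariant keeps the [mB] steps since the last such term
    [s0] apart; during these the bound [c] holds because [MATCHRT] creates no height above [c]. *)
Lemma derivation_bounded F ar (A B : set (rule F)) step
    (I : set (term (annot F))) c K :
  let mA := step (match_trs A) in let mB := step (MATCHRT c B) in
  (forall rl, (A `|` B) rl -> is_rule ar rl) -> nonduplicating (A `|` B) ->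
  liftable_step ar (A `|` B) step -> ~ collapsing A ->
  (forall rl, (A `|` B) rl -> fsize rl.2 <= K) ->
  bounded_by c (Succ (modulo mA mB) I) ->
  forall k s t, derivation (rstep A) (rstep B) k s t -> ground_wt ar s ->
  forall s', base s' = s -> all (geq c) (height_seq s') ->
    (exists i s0, [/\ I i, star (modulo mA mB) i s0 & star mB s0 s']) ->
  k <= weight (level_weight K c) s'.
Proof.
move=> mA mB rules nd lift ncA KP bnd k s t.
have mono := @level_weight_antitone K c.
set w := level_weight K c.
elim=> [//|{}k {}s s1 {}t st _ IH gs|{}k {}s s1 {}t st _ IH gs] s' Es cs
  [i [s0 [Ii is0 s0s]]].
- have gs1 : ground_wt ar s1.
    by apply: ground_wt_rstep st gs => rl H; apply: rules; left.
  case: st => l [r [p [sg [Alr Hs Es1]]]]; subst s.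
  have ABlr : (A `|` B) (l, r) by left.
  have [l' [El cl Hstep]] :=
    lift_step lift ABlr (rules _ ABlr) (nd _ ABlr) gs Hs cs.
  have [_ _ /= nv _] := rules _ ABlr.
  have [[f h] [ls El']] : exists f ls, l' = Fun f ls.
    by case: (l') El => [x /esym /nv|f ls] //; exists f, ls.
  have [m [Hm mmin]] : exists m, is_min (heights l') m.
    by apply: (@is_min_exists _ h); apply/heightsP; rewrite El' inE eqxx.
  have [s1' [ss1 Es1' _ dins w1]] := Hstep (match_trs A) m.+1
    (ex_intro _ l (ex_intro _ r (ex_intro _ l' (ex_intro _ m
      (And4 Alr El (conj Hm mmin) erefl))))).
  rewrite -Es1 in Es1'.
  (* The pending [mB] steps and the match step form one [modulo] step, so boundedness applies to
     [s1']. *)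
  have step1 : star (modulo mA mB) i s1'.
    apply: rt_trans is0 _; apply: rt_step; exists s'; split=> //.
    by exists s1'; split=> //; apply: rt_refl.
  have succ1 : Succ (modulo mA mB) I s1'.
    split; last by exists i.
    have : ground s1 by have := gs1; rewrite ground_wtE => /andP[].
    by rewrite /ground -Es1' /base vars_map_sym.
  have cs1 : all (geq c) (height_seq s1').
    by apply/allP => j /heightsP; apply: bnd succ1 j.
  have fr : 0 < fsize r.
    by case: (r) Alr => [x Alx|//]; case: ncA; exists (l, Var x), x.
  have mc : m.+1 <= c by apply: (allP cs1); apply: dins.
  have H1 := IH gs1 s1' Es1' cs1.
  have {}H1 : k <= weight w s1'.
    by apply: H1; exists i, s1'; split=> //; apply: rt_refl.
  have H2 := w1 w mono.
  have H3 : fsize r * w m.+1 <= K * w m.+1.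
    by rewrite leq_mul2r (KP _ ABlr) orbT.
  have H4 : K * w m.+1 < w m := level_weight_lt K mc.
  have H5 : w m <= weight w l' by apply: leq_weight; apply/heightsP.
  by clear -H1 H2 H3 H4 H5; lia.
- have gs1 : ground_wt ar s1.
    by apply: ground_wt_rstep st gs => rl H; apply: rules; right.
  case: st => l [r [p [sg [Blr Hs Es1]]]]; subst s.
  have ABlr : (A `|` B) (l, r) by right.
  have [l' [El cl Hstep]] :=
    lift_step lift ABlr (rules _ ABlr) (nd _ ABlr) gs Hs cs.
  have [_ _ /= nv _] := rules _ ABlr.
  have [f [h [ls El']]] : exists f h ls, l' = Fun (f, h) ls.
    by case: (l') El => [x /esym /nv|[f h] ls] //; exists f, h, ls.
  have root : fun_at l' [::] = Some (f, h) by rewrite El'.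
  have hin : h \in height_seq l' by rewrite El' inE eqxx.
  have hc : h <= c := allP cl h hin.
  (* It is enough that the symbols created weigh no more than those of [l']. *)
  suff [d [Bd dc wd]] : exists d, [/\ MATCHRT c B (l', lift_to d r), d <= c
      & fsize r * w d <= weight w l'].
    have [s1' [ss1 Es1' cs1 _ w1]] := Hstep _ _ Bd.
    rewrite -Es1 in Es1'.
    have H1 := IH gs1 s1' Es1' (cs1 dc).
    have {}H1 : k <= weight w s1'.
      apply: H1; exists i, s0; split=> //.
      exact: rt_trans s0s (rt_step _ _ _ _ ss1).
    have H2 := w1 w mono.
    by clear -H1 H2 wd; lia.
  have Bl'r : B (base l', r) by rewrite El.
  have [flat|nflat] :=
    pselect (fsize r <= fsize (base l') /\ lift_to h (base l') = l').
    (* Here [minn c h] is [h], all of [l'] has height [h], and [r] has no more symbols. *)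
    exists h; split=> //.
      exists l', r, f, h, h; split=> // _; exact/esym/minn_idPr.
    have [size_le El2] := flat.
    rewrite /weight -El2 height_seq_lift big_nseq iter_addn_0 mulnC.
    by rewrite leq_mul2l size_le orbT.
  have [d dmin] := @is_min_exists ([set c] `|` [set k.+1 | k in heights l']) c
    (or_introl erefl).
  have [Hd dle] := dmin.
  have dc : d <= c by apply: dle; left.
  exists d; split=> //; first by exists l', r, f, h, d.
  (* Either [d] is [c], where the weight is 0, or [d] is one more than a height [j] of [l'], and
     that one symbol outweighs all of the new ones. *)
  case: Hd => [->|[j Hj Ej]].
    by rewrite /w /level_weight ltnn muln0.
  rewrite -Ej in dc *.
  apply: leq_trans (leq_weight w (proj1 (heightsP _ _) Hj)).
  apply/ltnW; apply: leq_ltn_trans (level_weight_lt K dc).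
  by rewrite leq_mul2r (KP _ ABlr) orbT.
Qed.

(** * From a split to a linear bound on the steps of its second component *)

Lemma finite_set_ubound T (A : set T) (f : T -> nat) :
  finite_set A -> exists K, forall x, A x -> f x <= K.
Proof.
move=> /(finite_image f)/finite_seqP[s Es]; exists (\max_(i <- s) i) => x Ax.
apply: (@leq_bigmax_seq _ s xpredT id) => //.
by have : [set f x | x in A] (f x) by [exists x]; rewrite Es.
Qed.

Lemma fsize_le_term_size F (t : term F) : fsize t <= term_size t.
Proof.
elim/term_nested_ind: t => //= f ts IH; rewrite ltnS.
by elim: ts IH => //= t ts IHts [Ht /IHts]; apply: leq_add.
Qed.

Lemma linear_nonduplicating F ar (A : set (rule F)) :
  (forall rl, A rl -> is_rule ar rl) -> linear_trs A -> nonduplicating A.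
Proof.
move=> rules lin [l r] Alr x /=; have [/= ul ur] := lin _ Alr.
have [_ _ _ /= sub] := rules _ Alr.
by rewrite !count_uniq_mem //; case xr: (x \in vars r); rewrite // sub.
Qed.

Lemma is_trsU F ar (A B : set (rule F)) :
  is_trs ar A -> is_trs ar B -> is_trs ar (A `|` B).
Proof.
move=> [fA rA] [fB rB]; split; first by rewrite finite_setU.
by move=> rl [/rA|/rB].
Qed.

Lemma is_trs_sub F ar (A B : set (rule F)) :
  A `<=` B -> is_trs ar B -> is_trs ar A.
Proof.
by move=> AB [fB rB]; split; [exact: sub_finite_set fB | move=> rl /AB/rB].
Qed.

Lemma match_split_trs F ar (P : cp_problem F) R1 R2 :
  is_cp_problem ar P -> match_split ar P R1 R2 ->
  is_trs ar R1 /\ is_trs ar R2.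
Proof.
move=> [tP _ _] [E _ _]; rewrite E in tP.
by split; apply: is_trs_sub tP => x Hx; [left|right].
Qed.

Lemma match_split_steps F ar (P : cp_problem F) R1 R2 :
  is_ground_cp_problem ar P -> match_split ar P R1 R2 ->
  exists M, forall t k u, lang P t ->
    derivation (rstep R2) (rstep (R1 `|` weak P)) k t u -> k <= M * term_size t.
Proof.
move=> [cpP gP] spl; have [tR1 tR2] := match_split_trs cpP spl.
have [_ tS wtP] := cpP; have [_ nc cases] := spl.
set B := R1 `|` weak P in cases *.
have [finAB rules] : is_trs ar (R2 `|` B).
  by apply: is_trsU => //; apply: is_trsU.
have [K HK] := finite_set_ubound (fun rl => fsize rl.2) finAB.
have [step [lift nd [c bnd]]] : exists step,
    [/\ liftable_step ar (R2 `|` B) step,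
    nonduplicating (R2 `|` B) & exists c, bounded_by c
      (Succ (modulo (step (match_trs R2)) (step (MATCHRT c B)))
        (lift_to 0 @` lang P))].
  case: cases => [[lin bnd]|[nd bnd]].
    exists (@rstep (annot F)); split=> //; first by left.
    exact: linear_nonduplicating rules lin.
  by exists (raise_step ar); split=> //; right.
(* The constant is the weight of one symbol of height 0, since the lifting starts at
   [lift_to 0 t]. *)
exists (level_weight K c 0) => t k u Lt dtu.
have gt : ground_wt ar t by rewrite ground_wtE wtP // gP.
apply: leq_trans (derivation_bounded rules nd lift nc HK bnd dtu gt
  (base_lift 0 t) _ _) _.
- by rewrite height_seq_lift all_nseq orbT.
- exists (lift_to 0 t), (lift_to 0 t); split; try exact: rt_refl.
  by exists t.
rewrite /weight height_seq_lift big_nseq iter_addn_0 leq_mul2l.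
by rewrite fsize_le_term_size orbT.
Qed.

(** * Complexity estimates and soundness *)

Section Complexity.
Variables (K : realType) (F : Type).
Local Open Scope ereal_scope.

Lemma cp_ge0 n R (L : set (term F)) : 0 <= cp K n R L.
Proof. by apply: ereal_sup_ubound; left. Qed.

Lemma cp_ge n R (L : set (term F)) t u m : L t -> (term_size t <= n)%N ->
  pow_rel m R t u -> (m%:R)%:E <= cp K n R L.
Proof.
move=> Lt tn tu; apply: (@le_trans _ _ (dl K t R)).
  by apply: ereal_sup_ubound; exists m => //; exists u.
by apply: ereal_sup_ubound; right; exists t.
Qed.

Lemma cp_le n R (L : set (term F)) (x : \bar K) : 0 <= x ->
  (forall t u m, L t -> (term_size t <= n)%N -> pow_rel m R t u ->
    (m%:R)%:E <= x) ->
  cp K n R L <= x.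
Proof.
move=> x0 H; apply: ge_ereal_sup => _ [->//|[t [Lt tn] <-]].
by apply: ge_ereal_sup => _ [m [u tu] <-]; apply: H tu.
Qed.

(** Of [a + b] strict steps, the [b] steps of [R2] are at most [M * n], and [a] is at most the
    complexity of the new problem. The factor [M.+1] is at least 1, so it also covers the second
    summand. *)
Lemma match_split_cp ar (P : cp_problem F) R1 R2 :
  is_ground_cp_problem ar P -> match_split ar P R1 R2 ->
  exists M : nat, forall n, cp_of K P n <=
    (M.+1%:R)%:E * ((n%:R)%:E + cp_of K (CPProblem R1 (R2 `|` weak P) (lang P)) n).
Proof.
move=> gP spl; have [M HM] := match_split_steps gP spl.
have [E _ _] := spl; exists M => n.
have cp0 := cp_ge0 n (rel_step R1 (R2 `|` weak P)) (lang P).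
have n0 : 0 <= (n%:R : K)%:E by rewrite lee_fin ler0n.
have M0 : 0 <= (M.+1%:R : K)%:E by rewrite lee_fin ler0n.
rewrite /cp_of /=; apply: cp_le; first by rewrite mule_ge0 // adde_ge0.
move=> t u m Lt tn; rewrite E => /rel_step_pow_split[a [b [-> da db]]].
have [v /(cp_ge Lt tn) aC] := derivation_pow da.
have bM : (b <= M.+1 * n)%N.
  by apply: leq_trans (HM _ _ _ Lt db) _; apply: leq_mul.
rewrite ge0_muleDr // natrD EFinD addeC; apply: leeD.
  by rewrite -EFinM lee_fin -natrM ler_nat.
apply: le_trans aC _; rewrite -[leLHS]mul1e; apply: lee_wpmul2r => //.
by rewrite lee_fin ler1n.
Qed.

End Complexity.

Theorem theorem7p5 (K : realType) (F : Type) (ar : F -> nat)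
    (Phi : cp_problem F -> set (triple F))
    (Phi_split : forall P : cp_problem F, is_ground_cp_problem ar P ->
       (exists R1 R2 : set (rule F), match_split ar P R1 R2) ->
       exists R1 R2 : set (rule F), match_split ar P R1 R2 /\
         Phi P = [set (CPProblem R1 (R2 `|` weak P) (lang P), fun n : nat => n)])
    (Phi_id : forall P : cp_problem F, is_ground_cp_problem ar P ->
       ~ (exists R1 R2 : set (rule F), match_split ar P R1 R2) ->
       Phi P = [set (P, fun _ : nat => 0)]) :
  cp_processor ar (is_ground_cp_problem ar) Phi /\
  sound K (is_ground_cp_problem ar) Phi.
Proof.
split=> P gP.
- have [spl|nspl] := pselect (exists R1 R2, match_split ar P R1 R2).
    have [R1 [R2 [{}spl ->]]] := Phi_split P gP spl.
    split=> [|_ ->]; first exact: finite_set1.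
    have [cpP _] := gP; have [tR1 tR2] := match_split_trs cpP spl.
    by have [_ tS wtP] := cpP; split=> //=; apply: is_trsU.
  rewrite (Phi_id P gP nspl); split=> [|_ ->]; first exact: finite_set1.
  by case: gP.
- have [spl|nspl] := pselect (exists R1 R2, match_split ar P R1 R2).
    have [R1 [R2 [{}spl ->]]] := Phi_split P gP spl.
    have [M HM] := match_split_cp K gP spl.
    (* Both sums range over one triple, so the estimate holds from threshold 0 on. *)
    exists M.+1%:R%R, 0; split=> [|n _]; first by rewrite ltr0n.
    by rewrite !fsbig_set1.
  rewrite (Phi_id P gP nspl); exists 1%R, 0; split=> // n _.
  by rewrite !fsbig_set1 /= add0e mul1e.
Qed.
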